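(* Let $\mathbb{X}=(X,\{X_v\}_{v\in V(X)})$ be a finite edge-trivial graph of groups, let $k=\#H(X)$, and write $c(v)=\#(X_v)$ for $v\in V(X)$. Let $W$ be the $k\times k$ half-edge adjacency matrix, indexed by $H(X)$, with entries $$W_{hh'}=\begin{cases} c(r(h'))-1, & h'=\overline h,\\ c(r(h')), & h'\neq\overline h\text{ and } r(\overline h)=r(h'),\\ 0, & r(\overline h)\neq r(h').\end{cases}$$ Then the Ihara zeta function of $\mathbb{X}$ satisfies $$\zeta(u,\mathbb{X})^{-1}=\det(I_k-Wu).$$
   Context: Graphs. A graph (with legs) $X$ consists of a set of vertices $V(X)$, a set of half-edges $H(X)$, a root map $r:H(X)\to V(X)$, and an involution $h\mapsto\overline{h}$ on $H(X)$. An orbit $\{h,\overline h\}$ of size 2 is an edge; a half-edge with $\overline h=h$ is a leg. All graphs are connected. A finite edge-trivial graph of groups $\mathbb{X}=(X,X_v)$ consists of a finite graph $X$ and a finite group $X_v$ for each $v\in V(X)$. A path of length $n\ge 1$ in $\mathbb{X}$ is a sequence $P=g_0h_1g_1h_2\cdots g_{n-1}h_n$ where $h_j\in H(X)$, $r(h_{j+1})=r(\overline{h_j})$ for $1\le j\le n-1$, and, setting $v_0=r(h_1)$, $v_j=r(\overline{h_j})$ for $1\le j\le n$, one has $g_j\in X_{v_j}$ for $0\le j\le n-1$. It is closed if $v_n=v_0$; closed paths have positive integer powers by concatenation. With indices taken modulo $n$, a closed path is reduced if for every $j\in\{1,\dots,n\}$ either $h_{j+1}\ne\overline{h_j}$ or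 $g_j\neq 1$. A closed reduced path $P$ is primitive if there is no path $R$ and $k\ge2$ with $P=R^k$. Two closed paths of the same length $n$ are equivalent if they differ by a cyclic shift, i.e. $g'_{j-1}=g_{j-1+s}$ and $h'_j=h_{j+s}$ for some $0\le s\le n-1$ and all $j\in\{1,\dots,n\}$. A prime $\mathfrak{p}$ of $\mathbb{X}$ is an equivalence class of primitive paths; $\ell(\mathfrak p)$ is the common length. The Ihara zeta function is $\zeta(u,\mathbb{X})=\prod_{\mathfrak p}(1-u^{\ell(\mathfrak p)})^{-1}$, the product over all primes of $\mathbb{X}$, which converges for sufficiently small complex $u$. *)

(* Defs.v *)
From HB Require Import structures.
From mathcomp Require Import all_boot all_order all_algebra all_fingroup.
From mathcomp Require Import finmap generic_quotient.
From mathcomp Require Import boolp classical_sets reals topology normedtype.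
From mathcomp Require Import summability.
From mathcomp Require Import complex.
Import GRing.Theory Num.Theory.
Import numFieldNormedType.Exports.

Set Implicit Arguments.
Unset Strict Implicit.
Unset Printing Implicit Defensive.

Local Open Scope classical_set_scope.
Local Open Scope quotient_scope.
Local Open Scope ring_scope.

(* The orbits of size 2 of [bar] are the edges, its fixed points the legs;
   loops and multiple edges are allowed. *)
Record graph := Graph {
  vertex : finType;
  half_edge : finType;
  root : half_edge -> vertex;
  bar : half_edge -> half_edge;
  barK : involutive bar
}.

Definition adjacent (X : graph) : rel (vertex X) :=
  fun v w => [exists h : half_edge X, (root h == v) && (root (bar h) == w)].

Definition connected_graph (X : graph) : Prop :=
  forall v w : vertex X, connect (@adjacent X) v w.

(* A finite edge-trivial graph of groups, without the connectedness of the
   underlying graph, which is the separate predicate [connected_graph]. *)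
Record graph_of_groups := GraphOfGroups {
  gog_graph :> graph;
  vertex_group : vertex gog_graph -> finGroupType
}.

(* A path g_0 h_1 g_1 h_2 ... g_(n-1) h_n is encoded as the sequence of its n
   steps (h_1, g_0), (h_2, g_1), ..., (h_n, g_(n-1)).  The condition that
   g_(j-1) is in the group at v_(j-1) is carried by the type of steps, because
   v_(j-1) = r(h_j) in every path. *)
Definition step (X : graph_of_groups) : Type :=
  {h : half_edge X & vertex_group (root h)}.
HB.instance Definition _ (X : graph_of_groups) := Finite.on (step X).

Section Paths.
Variable X : graph_of_groups.
Implicit Types (P R : seq (step X)).

Definition composable : rel (step X) :=
  fun x y => root (tag y) == root (bar (tag x)).

Definition is_path P : bool := (0 < size P)%N && sorted composable P.

Definition closed_path P : bool :=
  is_path P &&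
  (if P is x :: P' then root (bar (tag (last x P'))) == root (tag x) else false).

(* For x = (h_j, g_(j-1)) and y = (h_(j+1), g_j), the indices being taken
   modulo the length when this is used with [path.cycle]. *)
Definition reduced_turn : rel (step X) :=
  fun x y => (tag y != bar (tag x)) || (tagged y != 1%g).

Definition reduced P : bool := path.cycle reduced_turn P.

Definition path_power P (k : nat) : seq (step X) := flatten (nseq k P).

Definition primitive P : Prop :=
  [/\ closed_path P, reduced P &
      ~ exists R (k : nat), [/\ closed_path R, (2 <= k)%N & P = path_power R k]].

Definition primitive_path : Type := {P : seq (step X) | `[< primitive P >]}.
HB.instance Definition _ := SubChoice.on primitive_path.

Definition shift_equiv : rel primitive_path :=
  fun p q => [exists s : 'I_(size (val p)), val q == rot s (val p)].

Lemma primitive_size (P : primitive_path) : (0 < size (val P))%N.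
Proof. by case: P => P /= /asboolP[] /andP[] /andP[]. Qed.

Lemma shift_equivP (P Q : primitive_path) :
  reflect (exists s, val Q = rot s (val P)) (shift_equiv P Q).
Proof.
apply: (iffP existsP) => [[s /eqP->]|[s eQ]]; first by exists s.
have [lt_s|le_s] := ltnP s (size (val P)).
  by exists (Ordinal lt_s); rewrite eQ.
by exists (Ordinal (primitive_size P)); rewrite /= rot0 eQ rot_oversize.
Qed.

Lemma shift_equiv_equiv : equiv_class_of shift_equiv.
Proof.
split=> [P|P Q|Q P T].
- by apply/shift_equivP; exists 0%N; rewrite rot0.
- apply/shift_equivP/shift_equivP => -[s eQ].
    by exists (size (val P) - s)%N; rewrite eQ -(size_rot s) -/(rotr s _) rotK.
  by exists (size (val Q) - s)%N; rewrite eQ -(size_rot s) -/(rotr s _) rotK.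
- move=> /shift_equivP[s eQ] /shift_equivP[t eT]; apply/shift_equivP.
  have [le_s|lt_s] := leqP s (size (val P)); last first.
    by exists t; rewrite eT eQ (rot_oversize (ltnW lt_s)).
  have [le_t|lt_t] := leqP t (size (val P)); last first.
    by exists s; rewrite eT eQ rot_oversize ?size_rot // ltnW.
  by rewrite eT eQ rot_add_mod //; eexists.
Qed.

Canonical shift_equiv_equiv_rel := EquivRelPack shift_equiv_equiv.

Definition gog_prime : Type := {eq_quot shift_equiv}.
HB.instance Definition _ := Choice.on gog_prime.
HB.instance Definition _ := EqQuotient.on gog_prime.

Definition prime_length (p : gog_prime) : nat := size (val (repr p)).

Lemma prime_length_pi (P : primitive_path) :
  prime_length (\pi_gog_prime P) = size (val P).
Proof.
rewrite /prime_length; case: piP => Q /eqmodP /shift_equivP[s ->].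
by rewrite size_rot.
Qed.

End Paths.

(* [R[i]^o] is [R[i]] with the topology given by its modulus. *)
Definition partial_zeta (R : realType) (X : graph_of_groups) (u : R[i])
    (A : {fset gog_prime X}) : R[i]^o :=
  \prod_(p : A) (1 - u ^+ prime_length (val p))^-1.

(* Limit along the finite sets of primes ordered by inclusion, hence
   independent of any enumeration of the primes. *)
Definition zeta_converges (R : realType) (X : graph_of_groups) (u : R[i]) :
  Prop := cvg (@partial_zeta R X u @ totally).

Definition zeta (R : realType) (X : graph_of_groups) (u : R[i]) : R[i] :=
  lim (@partial_zeta R X u @ totally).

Definition half_edge_weight (K : nzRingType) (X : graph_of_groups)
    (h h' : half_edge X) : K :=
  if h' == bar h then #|vertex_group (root h')|%:R - 1
  else if root (bar h) == root h' then #|vertex_group (root h')|%:R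
  else 0.

Definition half_edge_matrix (K : nzRingType) (X : graph_of_groups) :
    'M[K]_#|half_edge X| :=
  \matrix_(i, j) half_edge_weight K (enum_val i) (enum_val j).

(* Main.v *)
(* Read a closed reduced path as a cyclic word over the finite set of steps
   whose consecutive letters form a turn.  A cyclic word is in a unique way a
   power of an aperiodic one, and an aperiodic word of length l has l distinct
   rotations, so the number of cyclic words of length n is the sum of the
   lengths of the primes whose length divides n.  That number is also tr (W^n),
   because W = C B where B C is the 0-1 turn matrix on steps.  Hence the
   polynomials D = det (1 - X W) and Q_A = prod_{p in A} (1 - X^l(p)), for a
   finite set A containing all primes of length at most N, have the same
   logarithmic derivative, and then the same coefficients, up to order N.

   For small r one has sum_p r^l(p) <= 1/2, so the i-th coefficient of Q_A is
   at most 2 r^(-i) in modulus for every A, and the same bound is inherited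
   by D.  For |u| <= r/8 the tail beyond order N is thus small uniformly in A,
   so that Q_A(u) tends to D(u), and |D(u) - 1| <= 1/2. *)

Require Import Defs.
From mathcomp Require Import all_boot all_order all_algebra all_fingroup.
From mathcomp Require Import ring finmap generic_quotient.
From mathcomp Require Import boolp classical_sets reals topology normedtype.
From mathcomp Require Import summability.
From mathcomp Require Import complex.
Import Order.TTheory GRing.Theory Num.Theory.
Import numFieldNormedType.Exports.

Set Implicit Arguments.
Unset Strict Implicit.
Unset Printing Implicit Defensive.

(** * Powers and roots of words *)

Section Powers.
Variable T : eqType.
Implicit Types (a b u v w R z : seq T) (k : nat).

Definition wpow w k := flatten (nseq k w).

Lemma wpowD w i j : wpow w (i + j) = wpow w i ++ wpow w j.
Proof. by rewrite /wpow nseqD flatten_cat. Qed.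

Lemma wpow1 w : wpow w 1 = w.
Proof. exact: cats0. Qed.

Lemma wpowS w k : wpow w k.+1 = w ++ wpow w k.
Proof. by []. Qed.

Lemma wpowM w i j : wpow (wpow w i) j = wpow w (i * j).
Proof. by elim: j => [|j IHj]; rewrite ?muln0 // mulnS wpowS IHj wpowD. Qed.

Lemma wpow_nil k : wpow [::] k = [::].
Proof. by elim: k. Qed.

Lemma size_wpow w k : size (wpow w k) = size w * k.
Proof. by elim: k => [|k IHk]; rewrite ?muln0 // wpowS size_cat IHk mulnS. Qed.

Lemma catC_wpow u v k : u ++ v = v ++ u -> u ++ wpow v k = wpow v k ++ u.
Proof.
move=> uv; elim: k => [|k IHk]; first by rewrite cats0.
by rewrite wpowS catA uv -!catA IHk.
Qed.

Lemma catC_prefix u v : size u <= size v -> u ++ v = v ++ u ->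
  exists2 v', v = u ++ v' & u ++ v' = v' ++ u.
Proof.
move=> le_uv uv; have vE : v = u ++ drop (size u) v.
  rewrite -{1}(cat_take_drop (size u) v); congr (_ ++ _).
  by have := congr1 (take (size u)) uv; rewrite take_size_cat // takel_cat.
exists (drop (size u) v) => //; move: uv; rewrite {}[v]vE drop_size_cat //.
by rewrite -catA => /eqP; rewrite eqseq_cat // eqxx => /eqP.
Qed.

Lemma catC_wpow_size u v k :
  u ++ v = v ++ u -> size v = size u * k -> v = wpow u k.
Proof.
elim: k v => [|k IHk] v uv; first by rewrite muln0 => /size0nil.
rewrite mulnS => size_v.
have le_uv : size u <= size v by rewrite size_v leq_addr.
have [v' vE uv'] := catC_prefix le_uv uv.
by rewrite wpowS -(IHk v') //; move: size_v; rewrite vE size_cat => /addnI.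
Qed.

(** The Euclidean algorithm on lengths: the shorter of two commuting words is a prefix of the longer
    one, and cancelling it, when nonempty, leaves a commuting pair of smaller total length. *)
Lemma catC_root u v : u ++ v = v ++ u ->
  exists z i j, u = wpow z i /\ v = wpow z j.
Proof.
have [m] := ubnP (size u + size v); elim: m u v => // m IHm u v lt_m uv.
wlog le_uv : u v lt_m uv / size u <= size v => [wl|].
  have [/wl|/ltnW le_vu] := leqP (size u) (size v); first exact.
  rewrite addnC in lt_m.
  have [z [i [j [-> ->]]]] := wl v u lt_m (esym uv) le_vu.
  by exists z, j, i.
have [u0|u_gt0] := posnP (size u).
  by exists v, 0, 1; rewrite wpow1 (size0nil u0).
have [v' vE uv'] := catC_prefix le_uv uv.
have [|z [i [j [uE v'E]]]] := IHm _ _ _ uv'.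
  move: lt_m; rewrite vE size_cat ltnS; apply/leq_trans.
  by rewrite ltn_add2l -{1}[size v']add0n ltn_add2r.
by exists z, i, (i + j); rewrite wpowD -uE -v'E.
Qed.

(** Both [u] and [v] commute with a power [W] of [w] at least as long as [u ++ v], so [u ++ v] and
    [v ++ u] are prefixes of [W] of the same length. *)
Lemma catC_trans w u v : w != [::] ->
  w ++ u = u ++ w -> w ++ v = v ++ w -> u ++ v = v ++ u.
Proof.
rewrite -size_eq0 -lt0n => w_gt0 wu wv; pose W := wpow w (size (u ++ v)).
have wW x : w ++ x = x ++ w -> x ++ W = W ++ x.
  by move=> wx; apply: catC_wpow.
have WE x y : x ++ W = W ++ x -> y ++ W = W ++ y ->
    size (x ++ y) <= size W -> x ++ y = take (size (x ++ y)) W.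
  move=> xW yW le_xyW; rewrite -(takel_cat (x ++ y) le_xyW) catA -xW -catA -yW.
  by rewrite catA take_size_cat.
have leW : size (u ++ v) <= size W by rewrite size_wpow leq_pmull.
have uvC : size (v ++ u) = size (u ++ v) by rewrite !size_cat addnC.
by rewrite (WE u v) ?wW // (WE v u) ?wW ?uvC.
Qed.

(* The empty word is its own zeroth power, hence not aperiodic. *)
Definition aperiodic w : Prop := forall R k, w = wpow R k -> k = 1.

Lemma aperiodic_neq0 w : aperiodic w -> w != [::].
Proof. by move=> apw; apply/eqP => w0; have := apw [::] 0 w0. Qed.

(** If [rot s w] is a power of [R], then rotation by [size R] fixes it. Rotations commute, so this
    rotation fixes [w] too, and [w] is a power of its own prefix of that length, with the same
    exponent. *)
Lemma aperiodic_rot s w : aperiodic w -> aperiodic (rot s w).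
Proof.
move=> apw R [|k] wE.
  by have := aperiodic_neq0 apw; rewrite -size_eq0 -(size_rot s) wE.
have size_w : size w = size R * k.+1 by rewrite -(size_rot s) wE size_wpow.
have leRw : size R <= size w by rewrite size_w leq_pmulr.
have rotR : rot (size R) w = w.
  apply: (@rot_inj s); rewrite rot_rot wE wpowS rot_size_cat.
  by rewrite (catC_wpow k (erefl (R ++ R))).
have w_cat := cat_take_drop (size R) w.
apply: (apw (take (size R) w)); rewrite -{1}w_cat wpowS; congr (_ ++ _).
apply: catC_wpow_size.
  by rewrite cat_take_drop -[LHS]rotR.
by rewrite size_drop size_takel // size_w mulnS addKn.
Qed.

(** A nontrivial rotation fixing [w] cuts it into two nonempty commuting pieces; these are powers of
    a common word, so [w] is a power of it with exponent at least 2. *)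
Lemma aperiodic_rot_id s w : aperiodic w -> s < size w -> rot s w = w -> s = 0.
Proof.
move=> apw lt_s rot_w; apply/eqP/negPn/negP; rewrite -lt0n => s_gt0.
have [|z [i [j [tE dE]]]] := @catC_root (take s w) (drop s w).
  by rewrite cat_take_drop -[LHS]rot_w.
have := apw z (i + j); rewrite wpowD -tE -dE cat_take_drop => /(_ erefl).
have: 0 < size (take s w) by rewrite size_takel // ltnW.
have: 0 < size (drop s w) by rewrite size_drop subn_gt0.
rewrite tE dE !size_wpow !muln_gt0 => /andP[_]; case: j {dE} => // j _.
by case: i {tE} => [|i]; rewrite ?andbF // addSn addnS.
Qed.

Lemma aperiodic_rot_inj w s s' : aperiodic w -> s < size w -> s' < size w ->
  rot s w = rot s' w -> s = s'.
Proof.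
move=> apw; wlog le_ss' : s s' / s <= s' => [wl lt_s lt_s' rot_eq|lt_s lt_s'].
  case/orP: (leq_total s s') => [|le_s's]; first by move/wl; apply.
  by apply/esym/wl.
rewrite -{1}(subnKC le_ss') rotD ?(subnKC le_ss') ?(ltnW lt_s') //.
move=> /rot_inj/esym/(aperiodic_rot_id apw) s's.
apply/eqP; rewrite eqn_leq le_ss' -subn_eq0 s's ?eqxx //.
exact: leq_ltn_trans (leq_subr _ _) lt_s'.
Qed.

(** Both words commute with their common power, hence with each other, so they have a common root;
    aperiodicity identifies each of them with that root. *)
Lemma aperiodic_root_unique u v i j : aperiodic u -> aperiodic v -> 0 < i ->
  wpow u i = wpow v j -> u = v.
Proof.
move=> apu apv i_gt0 uv.
have [|z [k [l [uE vE]]]] := @catC_root u v.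
  apply: (@catC_trans (wpow u i)); last 2 first.
  - by rewrite (catC_wpow i (erefl (u ++ u))).
  - by rewrite uv (catC_wpow j (erefl (v ++ v))).
  rewrite -size_eq0 size_wpow muln_eq0 negb_or size_eq0 aperiodic_neq0 //.
  by rewrite -lt0n.
by rewrite uE vE (apu _ _ uE) (apv _ _ vE).
Qed.

Lemma aperiodic_root w : w != [::] ->
  exists R k, [/\ aperiodic R, 0 < k & w = wpow R k].
Proof.
have [m] := ubnP (size w); elim: m w => // m IHm w lt_wm w_neq0.
(* A word without an aperiodic root would itself be aperiodic, since any proper root is shorter and
   has an aperiodic root by induction. *)
apply: contrapT => noroot; case: (noroot); exists w, 1.
rewrite wpow1; split=> //.
move=> R [|[|k]] wE //; first by rewrite wE in w_neq0.
have R_gt0 : 0 < size R.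
  rewrite lt0n size_eq0; apply: contraNneq w_neq0 => R0.
  by rewrite wE R0 wpow_nil.
have [||S [j [apS j_gt0 RE]]] := IHm R.
- by rewrite -ltnS (leq_trans _ lt_wm) // ltnS wE size_wpow ltn_Pmulr.
- by rewrite -size_eq0 -lt0n.
by case: noroot; exists S, (j * k.+2); rewrite wE RE wpowM muln_gt0 j_gt0.
Qed.

(** Repetition creates no new adjacent pairs: the junction between two copies is the wrap-around
    pair of [w]. *)
Lemma cycle_wpow (e : rel T) w k :
  0 < k -> path.cycle e (wpow w k) = path.cycle e w.
Proof.
case: w => [|x p]; case: k => // k _; first by rewrite wpow_nil.
rewrite wpowS cat_cons /path.cycle; elim: k => [|k IHk]; first by rewrite cats0.
by rewrite wpowS cat_cons -cat_rcons rcons_cat cat_path last_rcons IHk andbb.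
Qed.

End Powers.

(** * Counting cyclic words by primes *)

Section Words.
Variable S : finType.

Fixpoint words n : seq (seq S) :=
  if n is n'.+1 then [seq x :: w | x <- enum S, w <- words n'] else [:: [::]].

Lemma mem_words n w : (w \in words n) = (size w == n).
Proof.
elim: n w => [|n IHn] w; first by rewrite inE size_eq0.
apply/allpairsP/idP => [[[x v] /= [_ v_n ->]]|]; first by rewrite IHn in v_n.
by case: w => //= x w; rewrite eqSS -IHn; exists (x, w); rewrite mem_enum.
Qed.

Lemma words_uniq n : uniq (words n).
Proof.
elim: n => //= n IHn; apply: allpairs_uniq; rewrite ?enum_uniq //.
by move=> [x v] [y w] _ _ /= [-> ->].
Qed.

Lemma size_words n : size (words n) = (#|S| ^ n)%N.
Proof. by elim: n => //= n IHn; rewrite size_allpairs IHn -cardE expnS. Qed.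

End Words.

Section Primes.
Variable X : graph_of_groups.
Implicit Types (P w : seq (step X)) (p : gog_prime X) (A : {fset gog_prime X}).

(** Only the half-edge of the preceding step matters for a turn; this is what lets the turn matrix
    on steps factor through half-edges. *)
Definition turn_from (h : half_edge X) (y : step X) : bool :=
  (Defs.root (tag y) == Defs.root (bar h)) &&
  ((tag y != bar h) || (tagged y != 1%g)).

Definition turn : rel (step X) := fun x y => turn_from (tag x) y.

Lemma closed_pathE P :
  closed_path P = (P != [::]) && path.cycle (@composable X) P.
Proof.
rewrite /closed_path /is_path /path.cycle; case: P => [|x P] //=.
by rewrite rcons_path /composable eq_sym.
Qed.

Lemma cycle_turnE P :
  path.cycle turn P = path.cycle (@composable X) P && reduced P.
Proof.
rewrite /reduced; case: P => [|x P] //=.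
by elim: (rcons P x) {1 3 5}x => //= y s IHs z; rewrite IHs andbACA.
Qed.

(** A root of a closed path is again closed, its cyclic junctions being those of the power; exponent
    0 is ruled out because a closed path is nonempty. *)
Lemma primitiveE P : primitive P <-> path.cycle turn P /\ aperiodic P.
Proof.
rewrite cycle_turnE; split=> [[]|[/andP[cyc red] apP]].
  rewrite closed_pathE => /andP[P_neq0 cyc] red notpow; rewrite cyc; split=> //.
  move=> R [|[|k]] // PE; first by rewrite PE in P_neq0.
  case: notpow; exists R, k.+2; split=> //; rewrite closed_pathE.
  move: P_neq0 cyc; rewrite PE cycle_wpow // => P_neq0 ->; rewrite andbT.
  by apply: contraNneq P_neq0 => ->; rewrite wpow_nil.
split=> //; first by rewrite closed_pathE cyc aperiodic_neq0.
by case=> R [k [_ le2k /apP k1]]; rewrite k1 in le2k.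
Qed.

Definition prime_word p := val (repr p).

Lemma prime_word_cycle p : path.cycle turn (prime_word p).
Proof. by have /asboolP/primitiveE[] := valP (repr p). Qed.

Lemma prime_word_aperiodic p : aperiodic (prime_word p).
Proof. by have /asboolP/primitiveE[] := valP (repr p). Qed.

Lemma size_prime_word p : size (prime_word p) = prime_length p.
Proof. by []. Qed.

Lemma prime_length_gt0 p : 0 < prime_length p.
Proof. exact: primitive_size. Qed.

Lemma prime_word_rot p q s t : s <= prime_length p -> t <= prime_length q ->
  rot s (prime_word p) = rot t (prime_word q) -> p = q.
Proof.
move=> le_s le_t pq; rewrite -[p]reprK -[q]reprK; apply/eqmodP/shift_equivP.
have : rotr t (rot s (prime_word p)) = prime_word q by rewrite pq rotK.
rewrite /rotr size_rot rot_add_mod ?leq_subr // => /esym qE.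
by eexists; exact: qE.
Qed.

Lemma prime_of_word P : path.cycle turn P -> aperiodic P ->
  exists p s, [/\ s < prime_length p & P = rot s (prime_word p)].
Proof.
move=> cycP apP.
have primP : `[< primitive P >] by apply/asboolP/primitiveE.
pose Q : primitive_path X := exist _ P primP.
pose p : gog_prime X := (\pi Q)%qT; exists p.
have /shift_equivP[s PE] : shift_equiv (repr p) Q.
  by apply/eqmodP; rewrite reprK.
have [lt_s|le_s] := ltnP s (prime_length p); first by exists s.
exists 0; rewrite prime_length_gt0 rot0; split=> //.
by rewrite -[LHS]/(val Q) PE rot_oversize.
Qed.

(** For positive [n], these are the closed reduced words of length [n] whose aperiodic root
    represents a prime in [A], sorted by that prime and by the offset of the root. *)
Definition prime_powers A n : seq (seq (step X)) :=
  [seq wpow (rot s (prime_word p)) (n %/ prime_length p) |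
    p <- [seq p <- A | prime_length p %| n], s <- iota 0 (prime_length p)].

Lemma size_prime_powers A n :
  size (prime_powers A n) = \sum_(p <- A | prime_length p %| n) prime_length p.
Proof.
rewrite size_allpairs_dep sumnE big_map big_filter.
by apply: eq_bigr => p _; rewrite size_iota.
Qed.

(** The word determines its aperiodic root, the root determines the prime, and the offset is then
    recovered because an aperiodic word has distinct rotations. *)
Lemma prime_powers_uniq A n : 0 < n -> uniq (prime_powers A n).
Proof.
move=> n_gt0; apply: allpairs_uniq_dep; rewrite ?filter_uniq ?fset_uniq //.
  by move=> p _; apply: iota_uniq.
move=> _ _ /allpairsPdep[p [s [+ + ->]]] /allpairsPdep[q [t [+ + ->]]] /=.
rewrite !mem_filter !mem_iota /= !add0n => /andP[pn _] lt_s /andP[qn _] lt_t pq.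
have pq_rot : rot s (prime_word p) = rot t (prime_word q).
  apply: aperiodic_root_unique pq; try exact/aperiodic_rot/prime_word_aperiodic.
  by rewrite divn_gt0 ?prime_length_gt0 // dvdn_leq.
have epq := prime_word_rot (ltnW lt_s) (ltnW lt_t) pq_rot.
rewrite -epq in lt_t pq_rot *.
by rewrite (aperiodic_rot_inj (@prime_word_aperiodic p) lt_s lt_t pq_rot).
Qed.

Lemma prime_powers_cycle A n : 0 < n ->
  {subset prime_powers A n <= [seq w <- words (step X) n | path.cycle turn w]}.
Proof.
move=> n_gt0 _ /allpairsPdep[p [s [+ _ ->]]].
rewrite !mem_filter mem_words size_wpow size_rot size_prime_word.
move=> /andP[pn _]; rewrite mulnC divnK // eqxx andbT cycle_wpow.
  by rewrite rot_cycle prime_word_cycle.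
by rewrite divn_gt0 ?prime_length_gt0 // dvdn_leq.
Qed.

(** The aperiodic root of such a word satisfies the same turn condition and has length dividing [n],
    so its prime has been collected in [A]. *)
Lemma cycle_prime_powers A n : 0 < n ->
    (forall p, prime_length p <= n -> p \in A) ->
  {subset [seq w <- words (step X) n | path.cycle turn w] <= prime_powers A n}.
Proof.
move=> n_gt0 An w; rewrite mem_filter mem_words => /andP[cyc_w /eqP size_w].
have [|R [k [apR k_gt0 wE]]] := @aperiodic_root _ w.
  by rewrite -size_eq0 size_w -lt0n.
have [|p [s [lt_s RE]]] := @prime_of_word R _ apR.
  by rewrite -(cycle_wpow _ _ k_gt0) -wE.
have nE : n = prime_length p * k.
  by rewrite -size_w wE size_wpow RE size_rot.
apply/allpairsPdep; exists p, s; rewrite mem_filter mem_iota add0n lt_s.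
rewrite nE dvdn_mulr // mulKn ?prime_length_gt0 // -RE -wE; split=> //.
by rewrite An // nE leq_pmulr.
Qed.

Lemma sum_prime_length_le A n : 0 < n ->
  \sum_(p <- A | prime_length p %| n) prime_length p <=
  count (path.cycle turn) (words (step X) n).
Proof.
move=> n_gt0; rewrite -size_prime_powers -size_filter uniq_leq_size //.
  exact: prime_powers_uniq.
exact: prime_powers_cycle.
Qed.

Lemma sum_prime_length A n : 0 < n ->
    (forall p, prime_length p <= n -> p \in A) ->
  \sum_(p <- A | prime_length p %| n) prime_length p =
  count (path.cycle turn) (words (step X) n).
Proof.
move=> n_gt0 An; apply/eqP; rewrite eqn_leq sum_prime_length_le //=.
rewrite -size_prime_powers -size_filter uniq_leq_size ?filter_uniq //.
  exact: words_uniq.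
exact: cycle_prime_powers.
Qed.

Lemma primes_up_to N : exists A, forall p, prime_length p <= N -> p \in A.
Proof.
(* Words of length at most [N] are finite in number, and [insub] keeps the primitive ones. *)
pose s : seq (primitive_path X) :=
  pmap insub (flatten [seq words (step X) n | n <- iota 0 N.+1]).
exists [fset (\pi_(gog_prime X) P)%qT | P in s]%fset => p le_pN.
apply/imfsetP; exists (repr p); rewrite ?reprK //= mem_pmap_sub.
apply/flattenP; exists (words (step X) (prime_length p)).
  by apply/mapP; exists (prime_length p); rewrite ?mem_iota.
by rewrite mem_words.
Qed.

End Primes.

Local Open Scope classical_set_scope.
Local Open Scope ring_scope.

(** * Traces *)

Section RelMatrix.
Variables (S : finType) (K : nzRingType) (e : rel S).

Definition rel_matrix : 'M[K]_#|S| :=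
  \matrix_(i, j) (e (enum_val i) (enum_val j))%:R.

Lemma sum_enum_val (F : S -> K) :
  \sum_(i < #|S|) F (enum_val i) = \sum_(x <- enum S) F x.
Proof. by rewrite big_enum /= [RHS]big_enum_val. Qed.

(** The [n] letters of [w] are the intermediate points of a walk with [n.+1] edges. *)
Lemma rel_matrixX n i j : (rel_matrix ^+ n.+1) i j =
  \sum_(w <- words S n) (path e (enum_val i) (rcons w (enum_val j)))%:R.
Proof.
elim: n i => [|n IHn] i; first by rewrite expr1 big_seq1 mxE /= andbT.
rewrite exprS [LHS]mxE big_allpairs_dep.
rewrite -(sum_enum_val (fun x => \sum_(w <- words S n)
  (path e (enum_val i) (rcons (x :: w) (enum_val j)))%:R)).
apply: eq_bigr => k _; rewrite IHn mxE mulr_sumr.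
by apply: eq_bigr => w _; rewrite -natrM mulnb.
Qed.

Lemma tr_rel_matrixX n :
  \tr (rel_matrix ^+ n.+1) = (count (path.cycle e) (words S n.+1))%:R.
Proof.
rewrite -sum1_count natr_sum [RHS]big_mkcond big_allpairs_dep.
transitivity (\sum_(i < #|S|) \sum_(w <- words S n)
  (path e (enum_val i) (rcons w (enum_val i)))%:R : K).
  by apply: eq_bigr => i _; rewrite rel_matrixX.
rewrite (sum_enum_val (fun x =>
  \sum_(w <- words S n) (path e x (rcons w x))%:R)).
by do 2![apply: eq_bigr => ? _]; rewrite /path.cycle; case: (path _ _ _).
Qed.

End RelMatrix.

Lemma sum_turn_from (K : nzRingType) (X : graph_of_groups)
    (h h' : half_edge X) :
  \sum_(y : step X) (turn_from h y && (tag y == h'))%:R =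
  half_edge_weight K h h'.
Proof.
pose from k (g : vertex_group (Defs.root k)) := turn_from h (existT _ k g).
transitivity
  (\sum_(y : step X | pred1 h' (tag y) && from (tag y) (tagged y)) (1 : K)).
  rewrite [RHS]big_mkcond; apply: eq_bigr => -[k g] _.
  by rewrite /from /= andbC; case: (_ && _).
rewrite -(sig_big_dep _ from (fun _ _ => 1)).
rewrite big_pred1_eq sumr_const /half_edge_weight /from /turn_from /=.
have [->|ne] := eqVneq h' (bar h).
  (* Backtracking forbids the identity of the vertex group, which accounts for the [- 1] in the
     weight. *)
  rewrite eqxx /= [in RHS](cardD1 1%g) inE natrD addrAC subrr add0r; congr _%:R.
  by apply: eq_card => g; rewrite !inE andbT.
rewrite eq_sym; case: eqP => _; last by rewrite (@eq_card0 _ _ _).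
by congr _%:R; apply: eq_card.
Qed.

Lemma tr_half_edge_matrixX (K : comNzRingType) (X : graph_of_groups) n :
  \tr (half_edge_matrix K X ^+ n.+1) =
  (count (path.cycle (@turn X)) (words (step X) n.+1))%:R.
Proof.
pose S : finType := step X; rewrite -tr_rel_matrixX.
(* [C] passes from a half-edge to the steps that may follow it, and [B] forgets the group element of
   a step. *)
pose C : 'M[K]_(#|half_edge X|, #|S|) :=
  \matrix_(i, j) (turn_from (enum_val i) (enum_val j))%:R.
pose B : 'M[K]_(#|S|, #|half_edge X|) :=
  \matrix_(i, j) (tag (enum_val i) == enum_val j)%:R.
have -> : half_edge_matrix K X = C *m B.
  apply/matrixP => i j; rewrite !mxE -sum_turn_from -big_enum -sum_enum_val.
  by apply: eq_bigr => k _; rewrite !mxE -natrM mulnb.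
have -> : rel_matrix K (@turn X) = B *m C.
  apply/matrixP => i j; rewrite !mxE.
  rewrite (bigD1 (enum_rank (tag (enum_val i)))) //= big1 => [|k /eqP ne_k].
    by rewrite !mxE enum_rankK eqxx mul1r addr0.
  rewrite !mxE; case: eqP => [tE|_]; last by rewrite mul0r.
  by case: ne_k; rewrite tE enum_valK.
have -> : (C *m B) ^+ n.+1 = C *m ((B *m C) ^+ n *m B).
  elim: n => [|n IHn]; first by rewrite expr1 expr0 mul1mx.
  by rewrite exprS IHn [in RHS]exprS -!mulmxE !mulmxA.
by rewrite mxtrace_mulC -mulmxA exprSr mulmxE.
Qed.

(** * Logarithmic derivatives of polynomials *)

Section LogDerivative.
Variable K : numFieldType.
Implicit Types (p q s t : {poly K}) (N l : nat).

(* [X p' / p] equals [- t] modulo [X ^ (N + 1)]. *)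
Definition logd N p t : Prop :=
  forall n, (n <= N)%N -> ('X * p^`() + t * p)`_n = 0.

Lemma coef_logd p t n :
  ('X * p^`() + t * p)`_n = p`_n *+ n + \sum_(i < n.+1) t`_i * p`_(n - i).
Proof.
rewrite coefD coefXM coefM; case: n => [|n] /=; first by rewrite mulr0n.
by rewrite coef_deriv.
Qed.

Lemma logd1 N : logd N 1 0.
Proof. by move=> n _; rewrite derivC mulr0 mul0r addr0 coef0. Qed.

Lemma logdM N p q s t : logd N p s -> logd N q t -> logd N (p * q) (s + t).
Proof.
move=> ps qt n le_nN.
have -> : 'X * (p * q)^`() + (s + t) * (p * q) =
   ('X * p^`() + s * p) * q + p * ('X * q^`() + t * q).
  by rewrite derivM; ring.
rewrite coefD !coefM !big1 ?addr0 // => i _.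
  by rewrite qt ?mulr0 // (leq_trans (leq_subr _ _)).
by rewrite ps ?mul0r // (leq_trans _ le_nN) // -ltnS.
Qed.

Lemma logd_prod N (I : Type) (r : seq I) (F T : I -> {poly K}) :
  (forall i, logd N (F i) (T i)) ->
  logd N (\prod_(i <- r) F i) (\sum_(i <- r) T i).
Proof.
move=> FT; elim: r => [|i r IHr]; first by rewrite !big_nil; apply: logd1.
by rewrite !big_cons; apply: logdM.
Qed.

(** The polynomial is the truncation of the geometric series of [a X / (1 - a X)], which has no
    constant term. *)
Lemma logd_linear N (a : K) :
  logd N (1 - a *: 'X) (\poly_(i < N.+1) (if i is 0 then 0 else a ^+ i)).
Proof.
move=> n le_nN; rewrite derivB derivZ derivX derivC sub0r coefD coefXM.
rewrite coefN coefZ coefC mulrBr mulr1 coefB -scalerAr coefZ coefMX.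
rewrite !coef_poly ltnS le_nN.
case: n le_nN => [|[|n]] le_nN //=; first by rewrite mulr0 subr0 addr0.
  by rewrite mulr1 mulr0 subr0 expr1 addNr.
by rewrite mulr0 oppr0 add0r ltnS ltnW // -exprS subrr.
Qed.

(** The polynomial is the truncation of the series of [l X^l / (1 - X^l)], supported on the positive
    multiples of [l]. *)
Lemma logd_subXn N l : (0 < l)%N ->
  logd N (1 - 'X^l)
    (\poly_(i < N.+1) (if (0 < i)%N && (l %| i)%N then l%:R else 0)).
Proof.
move=> l_gt0 n le_nN; rewrite derivB derivC sub0r derivXn coefD coefXM.
rewrite coefN coefMn coefXn mulrBr mulr1 coefB [X in _ - X]coefMXn.
rewrite !coef_poly ltnS le_nN ltnS (leq_trans (leq_subr l n) le_nN) subn_gt0.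
case: n le_nN => [|n] le_nN /=; first by rewrite l_gt0 subr0 addr0.
have -> : (n == l.-1) = (n.+1 == l) by case: l l_gt0.
have [lt_nl|lt_ln|<-] := ltngtP n.+1 l.
- rewrite mul0rn oppr0 add0r addr0; case: ifP => // /(dvdn_leq (ltn0Sn _)).
  by rewrite leqNgt lt_nl.
- by rewrite mul0rn oppr0 add0r dvdn_subl ?dvdnn 1?ltnW // subrr.
- by rewrite dvdnn subr0 addNr.
Qed.

(** In degree [n] the equation expresses [n p_n] through strictly lower coefficients of [p], because
    [s] has no constant term; in characteristic 0 this recursion determines [p_n] for positive
    [n]. *)
Lemma logd_unique N p q s t :
    logd N p s -> logd N q t -> p`_0 = q`_0 -> s`_0 = 0 ->
    (forall n, (n <= N)%N -> s`_n = t`_n) ->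
  forall n, (n <= N)%N -> p`_n = q`_n.
Proof.
move=> ps qt pq0 s0 st; elim/ltn_ind => -[|n] IHn le_nN //.
have := etrans (ps _ le_nN) (esym (qt _ le_nN)).
rewrite !coef_logd !(big_ord_recl n.+1) /= -!(st 0)// s0 !mul0r !add0r.
have -> : \sum_(i < n.+1) t`_(bump 0 i) * q`_(n.+1 - bump 0 i) =
          \sum_(i < n.+1) s`_(bump 0 i) * p`_(n.+1 - bump 0 i).
  apply: eq_bigr => i _; rewrite /bump /= add1n subSS.
  rewrite IHn ?st ?ltnS ?leq_subr ?(leq_trans (ltn_ord i) le_nN) //.
  exact: leq_trans (leq_subr _ _) (ltnW le_nN).
by move/addIr/eqP; rewrite -subr_eq0 -mulrnBl mulrn_eq0 subr_eq0 => /eqP.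
Qed.

End LogDerivative.

Lemma trig_mulmx (R : pzRingType) n (A B : 'M[R]_n) :
  is_trig_mx A -> is_trig_mx B ->
  is_trig_mx (A *m B) /\ forall i, (A *m B) i i = A i i * B i i.
Proof.
move=> /is_trig_mxP Atrig /is_trig_mxP Btrig.
split=> [|i].
  apply/is_trig_mxP => i j lt_ij; rewrite mxE big1 // => k _.
  have [lt_ik|le_ki] := ltnP i k; first by rewrite Atrig ?mul0r.
  by rewrite Btrig ?mulr0 // (leq_ltn_trans le_ki).
rewrite mxE (bigD1 i) //= big1 ?addr0 // => k ne_ki.
have [lt_ik|le_ki] := ltnP i k; first by rewrite Atrig ?mul0r.
by rewrite Btrig ?mulr0 // ltn_neqAle le_ki andbT.
Qed.

Lemma trig_expmx (R : pzRingType) n (A : 'M[R]_n) k : is_trig_mx A ->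
  is_trig_mx (A ^+ k) /\ forall i, (A ^+ k) i i = A i i ^+ k.
Proof.
move=> Atrig; elim: k => [|k [IHtrig IHdiag]].
  split=> [|i]; last by rewrite !expr0 mxE eqxx.
  exact: (@scalar_mx_is_trig _ n 1).
rewrite exprS; have [ABtrig diag] := trig_mulmx Atrig IHtrig.
by split=> // i; rewrite [LHS]diag IHdiag exprS.
Qed.

(** After Schur triangularization to [T], the determinant is the product of the factors
    [1 - T_jj X], and the trace of [W ^+ i] is the sum of the [T_jj ^+ i]; the linear case applies
    to each factor. *)
Lemma logd_det (C : numClosedFieldType) n (W : 'M[C]_n) N :
  logd N (\det (1%:M - 'X *: map_mx polyC W))
    (\poly_(i < N.+1) (if i is 0 then 0 else \tr (W ^+ i))).
Proof.
case: n W => [|n] W.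
  rewrite det_mx00; have -> : \poly_(i < N.+1)
      (if i is 0 then 0 else \tr (W ^+ i)) = 0 :> {poly C}; last exact: logd1.
  apply/polyP => -[|i]; rewrite coef_poly coef0 //.
  by rewrite /mxtrace big_ord0 if_same.
have [//|P /unitarymx_unit Pu] := Schur W.
rewrite /similar_to conjumx //.
set T := P *m W *m invmx P => Ttrig.
have WE : W = invmx P *m T *m P by rewrite /T !mulmxA mulVmx // mul1mx mulmxKV.
clearbody T.
have WkE k : W ^+ k = invmx P *m T ^+ k *m P.
  elim: k => [|k IHk]; first by rewrite !expr0 mulmx1 mulVmx.
  have expmxS (A : 'M[C]_n.+1) : A ^+ k.+1 = A *m A ^+ k by rewrite exprS.
  by rewrite !expmxS IHk {1}WE !mulmxA mulmxK.
have -> : \det (1%:M - 'X *: map_mx polyC W) = \prod_i (1 - T i i *: 'X).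
  have -> : 1%:M - 'X *: map_mx polyC W =
     map_mx polyC (invmx P) *m (1%:M - 'X *: map_mx polyC T) *m map_mx polyC P.
    rewrite mulmxBr mulmxBl mulmx1 -map_mxM mulVmx // map_mx1; congr (_ - _).
    by rewrite -scalemxAr -scalemxAl -!map_mxM -WE.
  rewrite !det_mulmx mulrAC -det_mulmx -map_mxM mulVmx // map_mx1 det1 mul1r.
  rewrite det_trig.
    apply: eq_bigr => i _; rewrite !mxE eqxx mulrC mul_polyC //.
  move/is_trig_mxP: Ttrig => T0.
  apply/is_trig_mxP => i j lt_ij; rewrite !mxE T0 //.
  by rewrite mulr0 subr0 -val_eqE /= (ltn_eqF lt_ij).
have -> : \poly_(i < N.+1) (if i is 0 then 0 else \tr (W ^+ i)) =
   \sum_(j < n.+1) \poly_(i < N.+1) (if i is 0 then 0 else T j j ^+ i).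
  apply/polyP => i; rewrite coef_sum coef_poly.
  under eq_bigr do rewrite coef_poly.
  case: ifP => _; last by rewrite big1.
  case: i => [|i]; first by rewrite big1.
  rewrite WkE mxtrace_mulC mulmxA mulmxV // mul1mx.
  by apply: eq_bigr => j _; rewrite (trig_expmx _ Ttrig).2.
by apply: logd_prod => j; apply: logd_linear.
Qed.

(** * Coefficient bounds *)

Section Majorants.
Variable K : numFieldType.
Implicit Types (E : {poly K}) (r q x u M : K).

(** Turning every minus sign into a plus removes all cancellation between monomials. *)
Lemma norm_coef_prod1BXn (I : Type) (s : seq I) (l : I -> nat) i :
  `|(\prod_(j <- s) (1 - 'X^(l j)) : {poly K})`_i|
    <= (\prod_(j <- s) (1 + 'X^(l j)) : {poly K})`_i.
Proof.
elim: s i => [|j s IHs] i.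
  by rewrite !big_nil coefC; case: ifP; rewrite ?normr1 ?normr0.
rewrite !big_cons mulrBl mulrDl !mul1r coefB coefD !coefXnM.
apply: le_trans (ler_normB _ _) _; apply: lerD => //.
by case: ifP; rewrite ?normr0.
Qed.

(** A division-free form of the bound of the product by [1 / (1 - sum x)]. The induction step rests
    on [(1 - S) - (1 + x)(1 - x - S) = x (x + S)]. *)
Lemma prod1D_le (I : Type) (s : seq I) (x : I -> K) :
    (forall j, 0 <= x j) -> \sum_(j <- s) x j <= 1 ->
  \prod_(j <- s) (1 + x j) * (1 - \sum_(j <- s) x j) <= 1.
Proof.
move=> x_ge0; elim: s => [|j s IHs]; first by rewrite !big_nil subr0 mulr1.
rewrite !big_cons => sum_le1; set S := \sum_(_ <- s) _ in sum_le1 IHs *.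
have S_ge0 : 0 <= S by apply: sumr_ge0.
apply: le_trans (IHs _); last by apply: le_trans sum_le1; rewrite lerDr.
rewrite mulrAC mulrC ler_wpM2l ?prodr_ge0 // => [i _|].
  by rewrite addr_ge0.
rewrite -subr_ge0.
have -> : 1 - S - (1 + x j) * (1 - (x j + S)) = x j * (x j + S) by ring.
by rewrite mulr_ge0 ?addr_ge0.
Qed.

(** A Cauchy estimate: the majorant [G] has nonnegative coefficients, so each term is at most
    [G.[r]], and [G.[r] <= 1 / (1 - S) <= 2] since the sum [S] is at most 1/2. *)
Lemma coef_prod1BXn_le (I : Type) (s : seq I) (l : I -> nat) r i :
    0 <= r -> (\sum_(j <- s) r ^+ l j) *+ 2 <= 1 ->
  `|(\prod_(j <- s) (1 - 'X^(l j)) : {poly K})`_i| * r ^+ i <= 2.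
Proof.
move=> r_ge0 sum_le; set G := \prod_(j <- s) (1 + 'X^(l j)) : {poly K}.
have G_ge0 k : 0 <= G`_k by apply: le_trans (norm_coef_prod1BXn s l k).
apply: (@le_trans _ _ G.[r]).
  apply: le_trans (ler_wpM2r (exprn_ge0 i r_ge0) (norm_coef_prod1BXn s l i)) _.
  have [lt_i|le_i] := ltnP i (size G); last first.
    rewrite nth_default // mul0r horner_coef sumr_ge0 // => k _.
    by rewrite mulr_ge0 ?exprn_ge0.
  rewrite horner_coef (bigD1 (Ordinal lt_i)) //= lerDl sumr_ge0 // => k _.
  by rewrite mulr_ge0 ?exprn_ge0.
have -> : G.[r] = \prod_(j <- s) (1 + r ^+ l j).
  by rewrite horner_prod; apply: eq_bigr => j _; rewrite !hornerE.
have x_ge0 j : 0 <= r ^+ l j by rewrite exprn_ge0.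
set P := \prod_(j <- s) _; have P_ge0 : 0 <= P.
  by apply: prodr_ge0 => j _; rewrite addr_ge0.
have := @prod1D_le _ s (fun j => r ^+ l j) x_ge0; rewrite -/P.
set S := \sum_(j <- s) _ in sum_le *; have S_ge0 : 0 <= S by apply: sumr_ge0.
move=> /(_ (le_trans _ sum_le)); rewrite mulr2n lerDl S_ge0 => /(_ isT) PS_le1.
have : P <= (P * (1 - S)) *+ 2.
  rewrite -mulrnAr mulrnBl -[X in X <= _]mulr1 ler_wpM2l //.
  by rewrite mulr2n -addrA lerDl subr_ge0.
by move/le_trans; apply; rewrite lerMn2r.
Qed.

Lemma sum_expr_le2 q n : 0 <= q -> q *+ 2 <= 1 -> \sum_(i < n) q ^+ i <= 2.
Proof.
move=> q_ge0 q_le; elim: n => [|n IHn]; first by rewrite big_ord0.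
rewrite big_ord_recl expr0 [leRHS](_ : 2 = 1 + 1) // lerD2l.
under eq_bigr do rewrite lift0 exprS.
rewrite -mulr_sumr; apply: le_trans q_le; rewrite -mulr_natr.
exact: ler_wpM2l.
Qed.

(** The term of degree [i] is at most [M q^i], so the value is bounded by a geometric series that
    starts at degree [m]. *)
Lemma norm_horner_le E m r q u M :
    0 <= q -> q *+ 2 <= 1 -> `|u| <= q * r ->
    (forall i, (i < m)%N -> E`_i = 0) -> (forall i, `|E`_i| * r ^+ i <= M) ->
  `|E.[u]| <= M * q ^+ m * 2.
Proof.
move=> q_ge0 q_le u_le E0 E_le.
have M_ge0 : 0 <= M by apply: le_trans (E_le 0%N); rewrite expr0 mulr1.
have -> : E.[u] = \sum_(i < size (drop_poly m E)) E`_(i + m) * u ^+ (i + m).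
  rewrite -{1}(poly_take_drop m E).
  have -> : take_poly m E = 0.
    by apply/polyP => i; rewrite coef_take_poly coef0; case: ifP => // /E0.
  rewrite add0r hornerM hornerXn horner_coef mulr_suml.
  by apply: eq_bigr => i _; rewrite coef_drop_poly exprD mulrA.
apply: le_trans (ler_norm_sum _ _ _) _.
apply: (@le_trans _ _ (\sum_(i < size (drop_poly m E)) M * q ^+ m * q ^+ i)).
  apply: ler_sum => i _; rewrite -mulrA -exprD addnC normrM normrX.
  apply: (@le_trans _ _ (`|E`_(m + i)| * (q * r) ^+ (m + i))).
    by rewrite ler_wpM2l // lerXn2r // nnegrE ?(le_trans _ u_le).
  by rewrite exprMn mulrCA [leRHS]mulrC ler_wpM2l ?exprn_ge0.
rewrite -mulr_sumr ler_wpM2l ?mulr_ge0 ?exprn_ge0 //.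
exact: sum_expr_le2.
Qed.

End Majorants.

(** * Convergence *)

Section Determinant.
Variables (C : numClosedFieldType) (X : graph_of_groups).
Implicit Types (A : {fset gog_prime X}).

Definition prime_poly A : {poly C} :=
  \prod_(p <- A) (1 - 'X^(prime_length p)).

Definition half_edge_poly : {poly C} :=
  \det (1%:M - 'X *: map_mx polyC (half_edge_matrix C X)).

Lemma horner_half_edge_poly (u : C) :
  half_edge_poly.[u] = \det (1%:M - u *: half_edge_matrix C X).
Proof.
rewrite -[LHS]/(horner_eval u _) -det_map_mx; congr (\det _).
apply/matrixP => i j; rewrite !mxE /= /horner_eval.
by rewrite !(hornerE, hornerMn).
Qed.

Lemma prime_poly0 A : (prime_poly A)`_0 = 1.
Proof.
rewrite -horner_coef0 horner_prod big1 // => p _.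
by rewrite !hornerE expr0n eqn0Ngt prime_length_gt0 subr0.
Qed.

Lemma half_edge_poly0 : half_edge_poly`_0 = 1.
Proof. by rewrite -horner_coef0 horner_half_edge_poly scale0r subr0 det1. Qed.

Lemma coef_prime_poly A N :
    (forall p, (prime_length p <= N)%N -> p \in A) ->
  forall n, (n <= N)%N -> (prime_poly A)`_n = half_edge_poly`_n.
Proof.
move=> AN.
have ldA := logd_prod A (fun p => @logd_subXn C N _ (@prime_length_gt0 X p)).
apply: (@logd_unique _ _ _ _ _ _ ldA (@logd_det C _ (half_edge_matrix C X) N)).
- by rewrite prime_poly0 half_edge_poly0.
- by rewrite coef_sum big1 // => p _; rewrite coef_poly.
move=> n le_nN; rewrite coef_sum coef_poly ltnS le_nN.
under eq_bigr do rewrite coef_poly ltnS le_nN.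
case: n le_nN => [|n] le_nN; first by rewrite big1.
rewrite -big_mkcond tr_half_edge_matrixX -(@sum_prime_length _ A) ?natr_sum //.
by move=> p /leq_trans/(_ le_nN)/AN.
Qed.

(** There are at most [#|step X| ^ n] primes of length [n], so the sum of the
    [step_radius ^+ prime_length p] is dominated by that of the [3^-n] for positive [n], which is
    1/2. The successor keeps the inverse meaningful when there are no steps. *)
Definition step_radius : C := (3 * #|{: step X}|.+1)%:R^-1.

Lemma step_radius_gt0 : 0 < step_radius.
Proof. by rewrite invr_gt0 ltr0n. Qed.

Lemma sum_prime_radius A :
  (\sum_(p <- A) step_radius ^+ prime_length p) *+ 2 <= 1.
Proof.
pose L := (\max_(p <- A) prime_length p).+1.
have step_le n : (0 < n)%N ->
    \sum_(p <- A | n == prime_length p) step_radius ^+ n <= 3^-1 ^+ n.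
  move=> n_gt0; have -> : \sum_(p <- A | n == prime_length p) step_radius ^+ n =
      step_radius ^+ n * (\sum_(p <- A | n == prime_length p) 1)%:R.
    by rewrite natr_sum mulr_sumr; apply: eq_bigr => p _; rewrite mulr1.
  have -> : 3^-1 ^+ n = step_radius ^+ n * (#|{: step X}|.+1 ^ n)%:R.
    rewrite natrX -exprMn /step_radius natrM invfM mulfVK //.
    by rewrite pnatr_eq0.
  rewrite ler_wpM2l ?exprn_ge0 ?(ltW step_radius_gt0) // ler_nat.
  apply: (@leq_trans (#|{: step X}| ^ n)%N); last by rewrite leq_exp2r.
  rewrite -size_words; apply: leq_trans (count_size (path.cycle (@turn X)) _).
  (* Each prime of length exactly [n] contributes its length, at least 1, to the sum over lengths
     dividing [n]. *)
  apply: leq_trans (sum_prime_length_le A n_gt0).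
  rewrite big_mkcond [leqRHS]big_mkcond leq_sum // => p _.
  by case: eqP => // ->; rewrite dvdnn prime_length_gt0.
have -> : \sum_(p <- A) step_radius ^+ prime_length p =
    \sum_(1 <= n < L) \sum_(p <- A | n == prime_length p) step_radius ^+ n.
  rewrite (exchange_big_dep predT) //= !big_seq; apply: eq_bigr => p pA.
  by rewrite big_nat1_eq prime_length_gt0 ltnS leq_bigmax_seq.
have geom k : (\sum_(1 <= n < k.+1) 3^-1 ^+ n) *+ 2 = 1 - 3^-1 ^+ k :> C.
  elim: k => [|k IHk]; first by rewrite big_geq // mul0rn expr0 subrr.
  rewrite big_nat_recr //= mulrnDl IHk exprS; set x := 3^-1 ^+ k.
  by field.
apply: (@le_trans _ _ ((\sum_(1 <= n < L) 3^-1 ^+ n) *+ 2)).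
  rewrite lerMn2r /= !big_nat ler_sum // => n /andP[n_gt0 _]; exact: step_le.
by rewrite geom gerBl exprn_ge0 // invr_ge0 ler0n.
Qed.

Lemma coef_prime_poly_le A i : `|(prime_poly A)`_i| * step_radius ^+ i <= 2.
Proof.
apply: coef_prod1BXn_le; last exact: sum_prime_radius.
exact/ltW/step_radius_gt0.
Qed.

(** Each single coefficient is shared with some [prime_poly A], and the bound there does not depend
    on [A]. *)
Lemma coef_half_edge_poly_le i : `|half_edge_poly`_i| * step_radius ^+ i <= 2.
Proof.
have [A AN] := primes_up_to X i.
by rewrite -(coef_prime_poly AN) // coef_prime_poly_le.
Qed.

(** With ratio 1/8 the tail bound [4 q^(N+1) 2] for a difference equals [q^N], and the bound [2 q 2]
    for the distance of the determinant to 1 equals 1/2. *)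
Let q : C := 8^-1.

Let q_ge0 : 0 <= q. Proof. by rewrite invr_ge0 ler0n. Qed.

Let q_le : q *+ 2 <= 1.
Proof. by rewrite -mulr_natr mulrC ler_pdivrMr ?ltr0n // mul1r ler_nat. Qed.

Lemma prime_poly_approx A N (u : C) : `|u| <= q * step_radius ->
    (forall p, (prime_length p <= N)%N -> p \in A) ->
  `|half_edge_poly.[u] - (prime_poly A).[u]| <= q ^+ N.
Proof.
move=> u_le AN; rewrite -hornerN -hornerD.
have -> : q ^+ N = 4 * q ^+ N.+1 * 2.
  by rewrite exprS; set x := q ^+ N; rewrite /q; field.
apply: norm_horner_le q_ge0 q_le u_le _ _ => i.
  by rewrite ltnS coefB => /(coef_prime_poly AN) ->; rewrite subrr.
rewrite coefB; apply: (@le_trans _ _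
  ((`|half_edge_poly`_i| + `|(prime_poly A)`_i|) * step_radius ^+ i)).
  by rewrite ler_wpM2r ?ler_normB ?exprn_ge0 ?(ltW step_radius_gt0).
rewrite mulrDl [leRHS](_ : 4 = 2 + 2); last by rewrite -natrD.
by rewrite lerD ?coef_half_edge_poly_le ?coef_prime_poly_le.
Qed.

Lemma half_edge_poly_neq0 (u : C) : `|u| <= q * step_radius ->
  half_edge_poly.[u] != 0.
Proof.
move=> u_le; have : `|(half_edge_poly - 1).[u]| <= 2 * q ^+ 1 * 2.
  apply: norm_horner_le q_ge0 q_le u_le _ _ => -[|i] //.
  - by rewrite coefB half_edge_poly0 coefC subrr.
  - by rewrite coefB half_edge_poly0 coefC subrr normr0 mul0r ler0n.
  by rewrite coefB coefC subr0 coef_half_edge_poly_le.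
rewrite !hornerE; apply: contraTneq => ->; rewrite sub0r normrN1.
by rewrite mulrAC -natrM ler_pdivlMr ?ltr0n // mul1r ler_nat.
Qed.

End Determinant.

#[local] Existing Instance totally_filter.

Section Convergence.
Variables (R : realType) (X : graph_of_groups) (u : R[i]).

Lemma partial_zetaE (A : {fset gog_prime X}) :
  partial_zeta u A = ((prime_poly R[i] A).[u])^-1.
Proof.
rewrite /partial_zeta.
rewrite -(big_seq_fsetE _ A predT (fun p => (1 - u ^+ prime_length p)^-1)) /=.
by rewrite prodfV horner_prod; congr _^-1; apply: eq_bigr => p _;
  rewrite !hornerE.
Qed.

Lemma prime_poly_cvg : `|u| <= 8^-1 * step_radius R[i] X ->
  (fun A : {fset gog_prime X} => (prime_poly R[i] A).[u] : R[i]^o) @ totally -->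
  ((half_edge_poly R[i] X).[u] : R[i]^o).
Proof.
move=> u_le; apply/cvgrPdist_lt => eps eps_gt0.
have [N ltN] : exists N, 8^-1 ^+ N < eps.
  (* In the order on [R[i]] a positive element is real, which reduces the choice of [N] to the
     Archimedean property of [R]. *)
  move: eps_gt0; case: eps => e i; rewrite ltcE /= => /andP[/eqP-> e_gt0].
  have [N ltN] : exists N, e^-1 < N%:R.
    by exists (Num.bound e^-1); rewrite archi_boundP // invr_ge0 ltW.
  exists N; have -> : 8^-1 ^+ N = ((8 ^+ N)^-1)%:C%C :> R[i].
    rewrite rmorphV ?unitfE ?expf_neq0 ?pnatr_eq0 //.
    by rewrite rmorphXn rmorph_nat exprVn.
  rewrite ltcR invf_plt ?posrE ?exprn_gt0 ?ltr0n //.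
  apply: lt_le_trans ltN _; rewrite -natrX ler_nat ltnW // ltn_expl //.
have [A AN] := primes_up_to X N.
exists A => // B /= AB; apply: le_lt_trans ltN.
by apply: prime_poly_approx => // p /AN; apply/fsubsetP.
Qed.

End Convergence.

Theorem proposition3p6 (R : realType) (X : graph_of_groups)
    (X_connected : connected_graph X) :
  \forall u \near (0 : R[i]^o),
    zeta_converges X u /\
    (zeta X u)^-1 = \det (1%:M - u *: half_edge_matrix R[i] X).
Proof.
have r_gt0 : 0 < 8^-1 * step_radius R[i] X.
  by rewrite mulr_gt0 ?invr_gt0 ?ltr0n // step_radius_gt0.
have nearU : \forall u \near (0 : R[i]^o), `|u| < 8^-1 * step_radius R[i] X.
  exact: nbhs0_lt.
apply: filterS nearU => u /ltW u_le.
have zeta_cvg : @partial_zeta R X u @ totally -->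
    (((half_edge_poly R[i] X).[u])^-1 : R[i]^o).
  rewrite (funext (partial_zetaE u)).
  (* The partial products are the inverses of the [prime_poly] values; inversion is continuous at
     their limit because that limit is nonzero on the chosen disc. *)
  apply: cvgV; first exact: half_edge_poly_neq0.
  exact: prime_poly_cvg.
split; first by apply/cvg_ex; eexists; exact: zeta_cvg.
by rewrite /zeta (norm_cvg_lim zeta_cvg) invrK horner_half_edge_poly.
Qed.
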